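(* Let $p>3$ be prime, $b,c\in\mathbb{Q}$, and assume $h(x)=x^{2p}+bx^p+c^p$ is irreducible over $\mathbb{Q}$. Let $\Delta=b^2-4c^p$. Working in a fixed algebraic closure of $\mathbb{Q}$, let $\alpha$ be a root of $x^2+bx+c^p$, choose $\beta$ with $\beta^p=\alpha$, put $\beta_1=c/\beta$, let $\zeta_p$ be a primitive $p$th root of unity, and for $i\in\mathbb{Z}_p$ let $D_i=\mathbb{Q}(\zeta_p^i\beta+\zeta_p^{-i}\beta_1)$. Let $K$ be the splitting field of $h$ over $\mathbb{Q}$ and let $L\subseteq K$ be the splitting field of $d_h(x)=D_p(x,c)+b$ over $\mathbb{Q}$. Then $K=L(\sqrt{\Delta})$, and for all $i$, $D_i\big(\zeta_p+\zeta_p^{-1},\ \sqrt{\Delta}(\zeta_p-\zeta_p^{-1})\big)\subseteq L$.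
   Context: The Dickson polynomials of the first kind are defined by $D_1(t,n)=t$, $D_2(t,n)=t^2-2n$, $D_k(t,n)=tD_{k-1}(t,n)-nD_{k-2}(t,n)$ for $k>2$. *)

(* Defs.v *)
From HB Require Import structures.
From mathcomp Require Import all_boot all_order all_algebra.
From mathcomp Require Import boolp classical_sets.

Set Implicit Arguments.
Unset Strict Implicit.
Unset Printing Implicit Defensive.

Import GRing.Theory.
Local Open Scope classical_set_scope.
Local Open Scope ring_scope.

(* Dickson polynomials of the first kind D_k(X, n). The value 2 at k = 0 is the
   usual convention; the other clauses never use it. *)
Fixpoint dickson (R : comNzRingType) (n : R) (k : nat) : {poly R} :=
  match k with
  | 0%N => 2%:R
  | 1%N => 'X
  | 2%N => 'X^2 - (n *+ 2)%:P
  | (k'.+1 as k1).+1 => 'X * dickson n k1 - n *: dickson n k'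
  end.

Section Subfields.
Variable C : fieldType.

(* divring_closed S: S contains 1 and is closed under x - y and x / y; in a
   field (where x / 0 = 0) this says exactly that S is a subfield. *)
Definition is_subfield (S : set C) : Prop := GRing.divring_closed (mem S).

(* A(S), the subfield of C generated by A and S *)
Definition adjoin (A S : set C) : set C := smallest is_subfield (A `|` S).

End Subfields.

Section OverRat.
Variables (C : fieldType) (iota : {rmorphism rat -> C}).

Definition ratfield : set C := range iota.

(* Meant for C algebraically closed: the subfield generated by all the roots of
   q in C is then the splitting field of q over Q inside C. *)
Definition splitting_field (q : {poly rat}) : set C :=
  adjoin ratfield [set x | root (map_poly iota q) x].

End OverRat.

(* Main.v *)
Require Import Defs.
From HB Require Import structures.
From mathcomp Require Import all_boot all_order all_algebra.
From mathcomp Require Import boolp classical_sets.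
From mathcomp Require Import ring.

Import GRing.Theory.
Local Open Scope classical_set_scope.
Local Open Scope ring_scope.

(** Write [t i = zeta^i beta + zeta^-i beta1].  Since [D_p(u + c/u, c) = u^p +
    (c/u)^p], the roots of [d_h] are exactly the [u + c/u] with [u] a root of
    [h]; the [t i] are among them, so [t i \in L], and [L] is contained in [K].
    From [t (i+1) + t (i-1) = (zeta + zeta^-1) t i], where [t 0] and [t 1] are
    not both zero, [L] contains [zeta + zeta^-1].  Up to sign, [sqrtDelta] is
    [beta^p - beta1^p = (beta - beta1) U] with [U] symmetric in [beta], [beta1],
    so [U] is a polynomial in [t 0] and [c], and [sqrtDelta (zeta - zeta^-1)] is
    [(t 1 - t (-1)) U \in L].  Finally [c] and [Delta] do not vanish because [h]
    is irreducible, so over [L(sqrtDelta)] one recovers [zeta], then [beta] and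
    [beta1] from [t 1 - t (-1) = (zeta - zeta^-1) (beta - beta1)]. *)

(** * Subfields and generated subfields *)

Section SubfieldClosure.
Context {C : fieldType}.
Implicit Types (A S : set C) (x y : C).

(** Passes from the boolean predicate [mem S] to propositional membership in [S]. *)
Lemma is_subfieldP S : is_subfield S <->
  [/\ S 1, forall x y, S x -> S y -> S (x - y)
         & forall x y, S x -> S y -> S (x / y)].
Proof.
split=> -[S1 SB SV]; split.
- exact: set_mem S1.
- by move=> x y Sx Sy; apply: set_mem; apply: SB; apply: mem_set.
- by move=> x y Sx Sy; apply: set_mem; apply: SV; apply: mem_set.
- exact: mem_set.
- by move=> x y /set_mem Sx /set_mem Sy; apply: mem_set; apply: SB.
- by move=> x y /set_mem Sx /set_mem Sy; apply: mem_set; apply: SV.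
Qed.

Lemma adjoin_subfield A S : is_subfield (adjoin A S).
Proof.
apply/is_subfieldP; split.
- by move=> F [/is_subfieldP[]].
- move=> x y Sx Sy F FAS; have [/is_subfieldP[_ FB _] _] := FAS.
  by apply: FB; [apply: Sx | apply: Sy].
- move=> x y Sx Sy F FAS; have [/is_subfieldP[_ _ FV] _] := FAS.
  by apply: FV; [apply: Sx | apply: Sy].
Qed.

Lemma sub_adjoinl A S : A `<=` adjoin A S.
Proof. by move=> x Ax F [_ sF]; apply: sF; left. Qed.

Lemma sub_adjoinr A S : S `<=` adjoin A S.
Proof. by move=> x Sx F [_ sF]; apply: sF; right. Qed.

Lemma adjoin_min A S F :
  is_subfield F -> A `<=` F -> S `<=` F -> adjoin A S `<=` F.
Proof.
by move=> sF AF SF x; apply; split=> // y [/AF|/SF].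
Qed.

Context {F : set C} (sF : is_subfield F).

Lemma subfield1 : F 1.
Proof. by have /is_subfieldP[] := sF. Qed.

Lemma subfieldB x y : F x -> F y -> F (x - y).
Proof. by have /is_subfieldP[_ FB _] := sF; apply: FB. Qed.

Lemma subfield_div x y : F x -> F y -> F (x / y).
Proof. by have /is_subfieldP[_ _ FV] := sF; apply: FV. Qed.

Lemma subfield0 : F 0.
Proof. by rewrite -(subrr 1); apply: subfieldB; exact: subfield1. Qed.

Lemma subfieldN x : F x -> F (- x).
Proof. by move=> Fx; rewrite -sub0r; apply: subfieldB => //; exact: subfield0. Qed.

Lemma subfieldD x y : F x -> F y -> F (x + y).
Proof.
by move=> Fx Fy; rewrite -[y]opprK; apply: subfieldB => //; exact: subfieldN.
Qed.

Lemma subfieldV x : F x -> F x^-1.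
Proof. by move=> Fx; rewrite -div1r; apply: subfield_div => //; exact: subfield1. Qed.

Lemma subfieldM x y : F x -> F y -> F (x * y).
Proof.
by move=> Fx Fy; rewrite -[y]invrK; apply: subfield_div => //; exact: subfieldV.
Qed.

Lemma subfieldX x n : F x -> F (x ^+ n).
Proof.
move=> Fx; elim: n => [|n IHn]; first by rewrite expr0; exact: subfield1.
by rewrite exprS; apply: subfieldM.
Qed.

Lemma subfield_nat n : F n%:R.
Proof.
elim: n => [|n IHn]; first exact: subfield0.
by rewrite -natr1; apply: subfieldD => //; exact: subfield1.
Qed.

(** Serves to extract [zeta] from [zeta + zeta^-1] and [zeta - zeta^-1], and [beta] from
    [beta + beta1] and [beta - beta1]. *)
Lemma subfield_half_sum x y : (2%:R : C) != 0 -> F (x + y) -> F (x - y) -> F x.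
Proof.
move=> nz2 Fs Fd; have -> : x = ((x + y) + (x - y)) / 2%:R by field.
by apply: subfield_div; [exact: subfieldD | exact: subfield_nat].
Qed.

(* The quotient [(x ^+ n - y ^+ n) / (x - y)] is symmetric in [x], [y]. *)
Lemma subfield_subrX x y n : F (x + y) -> F (x * y) ->
  exists2 U, F U & x ^+ n - y ^+ n = (x - y) * U.
Proof.
move=> Fs Fm.
(* The induction carries two consecutive exponents, since the differences [x ^+ n - y ^+ n] satisfy
   a second-order recurrence with coefficients [x + y] and [- (x * y)]. *)
suff [U [V [FU _ eqU _]]] : exists U V, [/\ F U, F V,
    x ^+ n - y ^+ n = (x - y) * U & x ^+ n.+1 - y ^+ n.+1 = (x - y) * V].
  by exists U.
elim: n => [|n [U [V [FU FV eqU eqV]]]].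
  exists 0, 1; split; [exact: subfield0 | exact: subfield1 | |].
    by rewrite !expr0 subrr mulr0.
  by rewrite !expr1 mulr1.
exists V, ((x + y) * V - x * y * U); split=> //.
  by apply: subfieldB; apply: subfieldM.
rewrite mulrBr mulrCA -eqV (mulrCA (x - y)) -eqU !exprS; ring.
Qed.

End SubfieldClosure.

(** * Roots of unity, and consequences of irreducibility *)

Lemma root_unity_mulr {C : fieldType} {n : nat} {z x y : C} :
  n.-primitive_root z -> y != 0 -> x ^+ n = y ^+ n ->
  exists i : nat, x = z ^+ i * y.
Proof.
move=> prim_z nz_y eq_xy.
have /(prim_rootP prim_z)[i xy_i] : (x / y) ^+ n = 1.
  by rewrite expr_div_n eq_xy divff // expf_neq0.
by exists i; rewrite -xy_i divfK.
Qed.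

(** Irreducibility would make [P] associate to [P * Q]; comparing sizes would then force [Q] to be
    constant. *)
Lemma irreducible_mulF {C : fieldType} (P Q : {poly C}) :
  (1 < size P)%N -> (1 < size Q)%N -> ~ irreducible_poly (P * Q).
Proof.
move=> sP sQ [_ /(_ P)]; rewrite neq_ltn sP orbT dvdp_mulr // => /(_ isT isT).
move=> /eqp_size; have nz (R : {poly C}) : (1 < size R)%N -> R != 0.
  by move=> sR; rewrite -size_poly_gt0 ltnW.
rewrite size_mul ?nz // => /eqP; rewrite -subn1 -addnBA ?(ltnW sQ) //.
by rewrite -{1}[size P]addn0 eqn_add2l eq_sym subn_eq0 leqNgt sQ.
Qed.

(** If [c = 0] the trinomial is ['X^p] times ['X^p + b]; if the discriminant vanishes it is the
    square of ['X^p + b / 2]. *)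
Lemma irreducible_trinomial_neq0 {p : nat} {b c : rat} : (0 < p)%N ->
  irreducible_poly ('X^(2 * p) + b *: 'X^p + (c ^+ p)%:P) ->
  c != 0 /\ b ^+ 2 - 4%:R * c ^+ p != 0.
Proof.
move=> p_gt0 irr.
have sXD (a : rat) : (1 < size ('X^p + a%:P : {poly rat})%R)%N.
  by rewrite size_XnaddC.
split; apply/eqP => eq0; move: irr.
  rewrite eq0 expr0n gtn_eqF //= polyC0 addr0.
  have -> : 'X^(2 * p) + b *: 'X^p = ('X^p + 0%:P) * ('X^p + b%:P) :> {poly rat}.
    by rewrite mul2n -addnn exprD -mul_polyC polyC0; ring.
  exact: irreducible_mulF.
have -> : c ^+ p = (b / 2%:R) ^+ 2.
  have -> : c ^+ p = (b ^+ 2 - (b ^+ 2 - 4%:R * c ^+ p)) / 4%:R by field.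
  by rewrite eq0; field.
have -> : 'X^(2 * p) + b *: 'X^p + ((b / 2%:R) ^+ 2)%:P
   = ('X^p + (b / 2%:R)%:P) * ('X^p + (b / 2%:R)%:P) :> {poly rat}.
  have {1}-> : b = b / 2%:R + b / 2%:R by field.
  by rewrite mul2n -addnn exprD -mul_polyC polyCD rmorphXn /=; ring.
exact: irreducible_mulF.
Qed.

(** * Values of Dickson polynomials *)

Lemma dicksonSS (R : comNzRingType) (n : R) k :
  dickson n k.+2 = 'X * dickson n k.+1 - n *: dickson n k.
Proof.
by case: k => //=; rewrite -expr2 -mul_polyC polyCMn mulr_natr.
Qed.

(** The power sums [u ^+ k + v ^+ k] obey the Dickson recurrence with [t = u + v] and [n = u * v].
    The conventional value 2 at [k = 0] equals [u ^+ 0 + v ^+ 0], so the induction can start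
    there. *)
Lemma horner_dickson (R S : comNzRingType) (f : {rmorphism R -> S}) n (u v : S) k :
  u * v = f n -> (map_poly f (dickson n k)).[u + v] = u ^+ k + v ^+ k.
Proof.
move=> uv.
suff [] : (map_poly f (dickson n k)).[u + v] = u ^+ k + v ^+ k /\
  (map_poly f (dickson n k.+1)).[u + v] = u ^+ k.+1 + v ^+ k.+1 by [].
elim: k => [|k [IHk IHk1]].
  by rewrite /= map_polyX hornerX rmorph_nat hornerMn hornerE !expr0 !expr1.
split=> //.
rewrite dicksonSS rmorphB rmorphM /= map_polyX map_polyZ !hornerE IHk IHk1 -uv.
by rewrite !exprS; ring.
Qed.

(** Take for [u] a root of [T^2 - x T + c], and [v = x - u]. *)
Lemma exists_sum_eq_mul_eq {C : closedFieldType} (x c : C) :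
  exists u v, u + v = x /\ u * v = c.
Proof.
have [u] := @solve_monicpoly C 2 (fun i => if i == 0%N then - c else x) isT.
rewrite !big_ord_recl big_ord0 /= => eq_u.
exists u, (x - u); split; first by rewrite addrC subrK.
by rewrite mulrBr -expr2 eq_u; ring.
Qed.

(** * Roots of the trinomial and of its Dickson companion *)

Section Roots.
Context {Omega : closedFieldType} {iota : {rmorphism rat -> Omega}}.
Context {p : nat} {b c : rat} {alpha alpha1 : Omega}.
Hypotheses (c_neq0 : c != 0).
Hypotheses (alphaD : alpha + alpha1 = - iota b).
Hypotheses (alphaM : alpha * alpha1 = iota c ^+ p).

(** By Vieta, the trinomial factors as [('X^p - alpha) * ('X^p - alpha1)]. *)
Lemma root_trinomialE u :
  root (map_poly iota ('X^(2 * p) + b *: 'X^p + (c ^+ p)%:P)) u =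
  (u ^+ p == alpha) || (u ^+ p == alpha1).
Proof.
rewrite /root !rmorphD /= map_polyZ !map_polyXn map_polyC /= !hornerE.
rewrite -[u ^+ p == _]subr_eq0 -[u ^+ p == alpha1]subr_eq0 -mulf_eq0.
congr (_ == 0).
rewrite rmorphXn -alphaM -[iota b]opprK -alphaD mul2n -addnn exprD; ring.
Qed.

(** Multiplying [d_h(u + v) = u^p + v^p + b] by the nonzero [u^p] gives [h(u)]. *)
Lemma root_dicksonE u v : u * v = iota c ->
  root (map_poly iota (dickson c p + b%:P)) (u + v) =
  (u ^+ p == alpha) || (u ^+ p == alpha1).
Proof.
move=> uv.
rewrite -root_trinomialE /root !rmorphD /= map_polyC hornerD hornerC.
rewrite (horner_dickson _ _ _ _ _ _ _ uv).
rewrite map_polyZ !map_polyXn map_polyC /= !hornerE.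
have nz_u : u ^+ p != 0.
  rewrite expf_neq0 //; apply: contraNneq c_neq0 => u0.
  by move: uv; rewrite u0 mul0r => /esym/eqP; rewrite fmorph_eq0.
rewrite -[LHS](mulrI_eq0 _ (mulfI nz_u)); congr (_ == 0).
by rewrite rmorphXn /= -uv exprMn mul2n -addnn exprD; ring.
Qed.

End Roots.

Lemma natf_neq0_rat {C : fieldType} (iota : {rmorphism rat -> C}) n :
  (0 < n)%N -> (n%:R : C) != 0.
Proof.
by move=> n_gt0; rewrite -(rmorph_nat iota) fmorph_eq0 Num.Theory.pnatr_eq0 -lt0n.
Qed.

(** * Comparison of the two splitting fields *)

Theorem theorem5p1
  (Omega : closedFieldType) (iota : {rmorphism rat -> Omega})
  (algOmega : integralRange iota)
  (p : nat) (p_prime : prime p) (p_gt3 : (3 < p)%N)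
  (b c : rat)
  (h_irr : irreducible_poly ('X^(2 * p) + b *: 'X^p + (c ^+ p)%:P))
  (alpha beta zeta sqrtDelta : Omega)
  (h_alpha : root (map_poly iota ('X^2 + b *: 'X + (c ^+ p)%:P)) alpha)
  (h_beta : beta ^+ p = alpha)
  (h_zeta : p.-primitive_root zeta)
  (h_sqrtDelta : sqrtDelta ^+ 2 = iota (b ^+ 2 - 4%:R * c ^+ p)) :
  let beta1 := iota c / beta in
  let D (i : 'Z_p) :=
    adjoin (ratfield iota) [set zeta ^+ i * beta + zeta ^- i * beta1] in
  let K := splitting_field iota ('X^(2 * p) + b *: 'X^p + (c ^+ p)%:P) in
  let L := splitting_field iota (dickson c p + b%:P) in
  K = adjoin L [set sqrtDelta] /\
  (forall i : 'Z_p,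
     adjoin (D i) [set zeta + zeta^-1; sqrtDelta * (zeta - zeta^-1)] `<=` L).
Proof.
move=> beta1 D K L.
have p_gt0 := prime_gt0 p_prime.
have [c_neq0 Delta_neq0] := irreducible_trinomial_neq0 p_gt0 h_irr.
have ic_neq0 : iota c != 0 by rewrite fmorph_eq0.
have nz2 : (2%:R : Omega) != 0 by exact: (natf_neq0_rat iota).
have eq_alpha : alpha ^+ 2 + iota b * alpha + iota c ^+ p = 0.
  move: h_alpha; rewrite /root !rmorphD /= map_polyZ map_polyXn map_polyX.
  by rewrite map_polyC /= !hornerE rmorphXn => /eqP.
have beta_neq0 : beta != 0.
  apply/eqP => beta0; move/eqP: eq_alpha; rewrite -h_beta beta0.
  by rewrite expr0n gtn_eqF //= expr0n mulr0 !add0r expf_eq0 (negPf ic_neq0) andbF.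
have beta1_neq0 : beta1 != 0 by rewrite mulf_neq0 ?invr_eq0.
have betaM : beta * beta1 = iota c by rewrite mulrC divfK.
(* This is the other root of [x^2 + b x + c^p], as the next product and sum show. *)
pose alpha1 := beta1 ^+ p.
have alpha_neq0 : alpha != 0 by rewrite -h_beta expf_neq0.
have alphaM : alpha * alpha1 = iota c ^+ p by rewrite -h_beta -exprMn betaM.
have alphaD : alpha + alpha1 = - iota b.
  apply: (mulfI alpha_neq0); rewrite mulrDr alphaM.
  by apply/eqP; rewrite -subr_eq0 -eq_alpha; apply/eqP; ring.
have zeta_neq0 : zeta != 0.
  apply/eqP => z0; have /eqP := prim_expr_order h_zeta.
  by rewrite z0 expr0n gtn_eqF // eq_sym oner_eq0.
have zeta_p (i : nat) : (zeta ^+ i) ^+ p = 1.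
  by rewrite exprAC (prim_expr_order h_zeta) expr1n.
have zeta2_neq1 : zeta ^+ 2 != 1.
  by rewrite -(prim_order_dvd h_zeta) gtnNdvd // (ltn_trans _ p_gt3).
have zetaB_neq0 : zeta - zeta^-1 != 0.
  apply: contraNneq zeta2_neq1 => /subr0_eq z_eq.
  by rewrite expr2 {2}z_eq divff.
have sK : is_subfield K by exact: adjoin_subfield.
have sL : is_subfield L by exact: adjoin_subfield.
have ratL r : L (iota r) by apply: sub_adjoinl; exists r.
have ratK r : K (iota r) by apply: sub_adjoinl; exists r.
have rootK u : (u ^+ p == alpha) || (u ^+ p == alpha1) -> K u.
  by move=> u_root; apply: sub_adjoinr; rewrite /= (root_trinomialE alphaD alphaM).
have Kbeta : K beta by apply: rootK; rewrite h_beta eqxx.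
have Kbeta1 : K beta1 by apply: rootK; rewrite eqxx orbT.
have tL (i : nat) : L (zeta ^+ i * beta + zeta ^- i * beta1).
  apply: sub_adjoinr; rewrite /= (root_dicksonE c_neq0 alphaD alphaM).
    by rewrite exprMn zeta_p mul1r h_beta eqxx.
  by rewrite mulrACA divff ?expf_neq0 // mul1r.
have t0L : L (beta + beta1) by have := tL 0%N; rewrite expr0 invr1 !mul1r.
have t1L : L (zeta * beta + zeta^-1 * beta1) by have := tL 1%N; rewrite expr1.
have tNL : L (zeta^-1 * beta + zeta * beta1).
  (* The exponents in [tL] are natural numbers, so [p.-1] stands in for -1. *)
  have := tL p.-1; have -> : zeta ^+ p.-1 = zeta^-1.
    apply: (mulfI zeta_neq0).
    by rewrite -exprS prednK // (prim_expr_order h_zeta) divff.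
  by rewrite invrK.
have zetaDL : L (zeta + zeta^-1).
  (* If [t 0 = 0] then [t 1 = (zeta - zeta^-1) * beta] is nonzero, and one divides [t 2 + t 0] by
     it; otherwise one divides [t 1 + t (-1)] by [t 0]. *)
  have [t0|nz_t0] := eqVneq (beta + beta1) 0.
    have eq_beta1 : beta1 = - beta by apply/eqP; rewrite -addr_eq0 addrC t0.
    have nz_t1 : zeta * beta + zeta^-1 * beta1 != 0.
      by rewrite eq_beta1 mulrN -mulrBl mulf_neq0.
    have -> : zeta + zeta^-1 = ((zeta ^+ 2 * beta + zeta ^- 2 * beta1)
        + (beta + beta1)) / (zeta * beta + zeta^-1 * beta1).
      by apply: (mulIf nz_t1); rewrite divfK //; field.
    by apply: (subfield_div sL) => //; apply: (subfieldD sL).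
  have -> : zeta + zeta^-1 = ((zeta * beta + zeta^-1 * beta1)
      + (zeta^-1 * beta + zeta * beta1)) / (beta + beta1).
    by apply: (mulIf nz_t0); rewrite divfK //; ring.
  by apply: (subfield_div sL) => //; apply: (subfieldD sL).
have zetaBL : L ((zeta - zeta^-1) * (beta - beta1)).
  have -> : (zeta - zeta^-1) * (beta - beta1) =
    (zeta * beta + zeta^-1 * beta1) - (zeta^-1 * beta + zeta * beta1) by ring.
  exact: (subfieldB sL).
(* Both sides square to the discriminant; the sign is harmless, subfields being closed under
   opposites. *)
have sqrtDeltaE : sqrtDelta = alpha - alpha1 \/ sqrtDelta = - (alpha - alpha1).
  have /eqP : sqrtDelta ^+ 2 = (alpha - alpha1) ^+ 2.
    rewrite h_sqrtDelta rmorphB /= [iota (4%:R * _)]rmorphM /= !rmorphXn /=.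
    by rewrite rmorph_nat -alphaM -[iota b]opprK -alphaD; ring.
  by rewrite eqf_sqr => /orP[] /eqP; [left | right].
have alphaBL : L ((alpha - alpha1) * (zeta - zeta^-1)).
  have [|U LU eqU] := subfield_subrX sL beta beta1 p t0L; first by rewrite betaM.
  by rewrite -h_beta eqU mulrC mulrA; apply: (subfieldM sL).
have sqrtDeltaL : L (sqrtDelta * (zeta - zeta^-1)).
  by case: sqrtDeltaE => -> //; rewrite mulNr; apply: (subfieldN sL).
have sub_LK : L `<=` K.
  apply: adjoin_min => // [_ [r _ <-] //|x].
  (* Any root [x] of [d_h] is thus [u + c / u], where [u] is a root of [h] and so lies in [K]. *)
  have [u [v [<- uv]]] := exists_sum_eq_mul_eq x (iota c).
  rewrite /= (root_dicksonE c_neq0 alphaD alphaM _ _ uv) => /rootK Ku.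
  have u_neq0 : u != 0.
    by apply: contraNneq ic_neq0 => u0; rewrite -uv u0 mul0r.
  have -> : v = iota c / u by apply: (mulfI u_neq0); rewrite uv mulrC divfK.
  by apply: (subfieldD sK) => //; apply: (subfield_div sK).
split; last first.
  move=> i; apply: adjoin_min => //.
    by apply: adjoin_min => // [_ [r _ <-] //|x ->].
  by move=> x [] ->.
pose M := adjoin L [set sqrtDelta].
have sM : is_subfield M by exact: adjoin_subfield.
have LM : L `<=` M by exact: sub_adjoinl.
apply/seteqP; split; last first.
  apply: adjoin_min => // _ ->.
  have KaB : K (alpha - alpha1).
    by rewrite -h_beta; apply: (subfieldB sK) => //; apply: (subfieldX sK).
  by case: sqrtDeltaE => -> //; apply: (subfieldN sK).
have sqrtDelta_neq0 : sqrtDelta != 0.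
  by rewrite -sqrf_eq0 h_sqrtDelta fmorph_eq0.
(* Divide [sqrtDelta * (zeta - zeta^-1)], known to lie in [L], by [sqrtDelta]. *)
have zetaBM : M (zeta - zeta^-1).
  rewrite -[_ - _](mulKf sqrtDelta_neq0); apply: (subfieldM sM) => //; last exact: LM.
  by apply: (subfieldV sM) => //; apply: sub_adjoinr.
have zetaM : M zeta.
  by apply: (subfield_half_sum sM zeta zeta^-1) => //; apply: LM.
have betaBM : M (beta - beta1).
  rewrite -[_ - _](mulKf zetaB_neq0); apply: (subfieldM sM) => //; last exact: LM.
  exact: (subfieldV sM).
have Mbeta : M beta by apply: (subfield_half_sum sM beta beta1) => //; apply: LM.
have Mbeta1 : M beta1.
  rewrite -[beta1](addrK beta) addrC; apply: (subfieldD sM) => //.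
    exact: (subfieldN sM).
  by rewrite addrC; apply: LM.
(* Every root of [h] is a power of [zeta] times [beta] or [beta1], all of which lie in [M]. *)
apply: adjoin_min => // [_ [r _ <-]|u]; first exact: LM.
rewrite /= (root_trinomialE alphaD alphaM) => /orP[] /eqP.
  rewrite -h_beta => /(root_unity_mulr h_zeta beta_neq0)[i ->].
  by apply: (subfieldM sM) => //; apply: (subfieldX sM).
move=> /(root_unity_mulr h_zeta beta1_neq0)[i ->].
by apply: (subfieldM sM) => //; apply: (subfieldX sM).
Qed.
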